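(* Let $\mu$ be a locally finite, even and non-negative Borel measure on $\mathbb{R}$ such that: (i) $\mu([-r,r])>0$ for each $r>0$; (ii) $\int_{\mathbb{R}}e^{\varepsilon|x|}\,d\mu(x)<\infty$ for some $\varepsilon>0$. Then $\mathbb{E}(\mu;\delta)=0$ for any $\delta\ge0$.
   Context: The exponential type of a not identically zero entire function $F:\mathbb{C}\to\mathbb{C}$ is $\tau(F)=\limsup_{|z|\to\infty}|z|^{-1}\log|F(z)|$, when this is finite; ''exponential type at most $\delta$'' means $\tau(F)\le\delta$ (the zero function is also allowed). An entire function is real entire if it is real-valued on $\mathbb{R}$. A function $F:\mathbb{R}\to\mathbb{R}$ is eventually non-negative if $F(x)\ge0$ for all sufficiently large $|x|$; then $r(F):=\inf\{r>0: F(x)\ge0\text{ for all }|x|\ge r\}$. For $\delta\ge0$, $\mathcal{E}(\mu;\delta)$ is the class of real entire functions $F:\mathbb{C}\to\mathbb{C}$ of exponential type at most $\delta$ such that $F|_{\mathbb{R}}\in L^1(\mathbb{R},\mu)$, $\int_{\mathbb{R}}F\,d\mu\le0$, and $F|_{\mathbb{R}}$ is eventually non-negative. $\mathbb{E}(\mu;\delta):=\inf\{r(F|_{\mathbb{R}}): 0\ne F\in\mathcal{E}(\mu;\delta)\}$. *)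

(* Defs.v *)
(* MathComp-Analysis, over an arbitrary [R : realType]; the complex numbers are
   [R[i]].  The alias [R[i]^o] gives access to the structure of normed module
   of [R[i]] over itself, so that [derivable] means complex-differentiable. *)
From HB Require Import structures.
From mathcomp Require Import all_boot all_order all_algebra.
From mathcomp Require Import all_classical all_reals all_analysis.
From mathcomp Require Import complex.

Set Implicit Arguments.
Unset Strict Implicit.
Unset Printing Implicit Defensive.

Import Order.TTheory GRing.Theory Num.Theory numFieldNormedType.Exports.

Local Open Scope classical_set_scope.
Local Open Scope ring_scope.
Local Open Scope complex_scope.

Definition entire (R : realType) (F : R[i]^o -> R[i]^o) : Prop :=
  forall z, derivable F z 1.

Definition real_entire (R : realType) (F : R[i]^o -> R[i]^o) : Prop :=
  entire F /\ forall x : R, complex.Im (F x%:C) = 0.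

Definition real_restr (R : realType) (F : R[i]^o -> R[i]^o) : R -> R :=
  fun x => complex.Re (F x%:C).

(* The filter "|z| --> oo"; [normc] is the real-valued modulus. *)
Definition cinfty_nbhs (R : realType) : set_system R[i]^o :=
  filter_from [set: R] (fun M => [set z | M < Normc.normc z]).

(* [lne] is the extended logarithm, with [lne 0 = -oo]. *)
Definition exp_type (R : realType) (F : R[i]^o -> R[i]^o) : \bar R :=
  limf_esup (fun z : R[i]^o =>
    ((Normc.normc z)^-1%:E * lne (Normc.normc (F z))%:E)%E) (@cinfty_nbhs R).

Definition exp_type_at_most (R : realType) (delta : R)
    (F : R[i]^o -> R[i]^o) : Prop :=
  (forall z, F z = 0) \/
  (exp_type F \is a fin_num /\ (exp_type F <= delta%:E)%E).

Definition eventually_nonneg (R : realType) (f : R -> R) : Prop :=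
  exists r : R, forall x, r <= `|x| -> 0 <= f x.

(* Infima are taken in [\bar R], where the infimum of the empty set is [+oo]
   (the real-valued [inf] would return 0). *)
Definition last_sign_change (R : realType) (f : R -> R) : \bar R :=
  ereal_inf [set r%:E | r in
    [set r : R | 0 < r /\ forall x, r <= `|x| -> 0 <= f x]].

Definition locally_finite (R : realType)
    (mu : {measure set (measurableTypeR R) -> \bar R}) : Prop :=
  forall x : R, exists U : set R, [/\ open U, U x & (mu U < +oo)%E].

Definition even_measure (R : realType)
    (mu : {measure set (measurableTypeR R) -> \bar R}) : Prop :=
  forall A : set (measurableTypeR R), measurable A ->
    mu [set - x | x in A] = mu A.

Definition sign_class (R : realType)
    (mu : {measure set (measurableTypeR R) -> \bar R}) (delta : R)
    : set (R[i]^o -> R[i]^o) :=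
  [set F | [/\ real_entire F,
               exp_type_at_most delta F,
               mu.-integrable setT (EFin \o real_restr F),
               (\int[mu]_x (real_restr F x)%:E <= 0)%E
             & eventually_nonneg (real_restr F)]].

Definition sign_uncertainty (R : realType)
    (mu : {measure set (measurableTypeR R) -> \bar R}) (delta : R) : \bar R :=
  ereal_inf [set last_sign_change (real_restr F) | F in
    [set F | sign_class mu delta F /\ exists z, F z <> 0]].

(* Main.v *)
(* The competitor is F = (x^2 - r^2) p^2 with p a real polynomial, so that F has
   exponential type 0 and is nonnegative for |x| >= r; what must be found is a p
   with \int F dmu <= 0.  Suppose there is none.  Put h(x) = sinc(e x / 4), e
   being the exponent in (ii).  The Taylor polynomials of h are dominated by
   exp(e|x| / 4), so by dominated convergence, replacing p by p times such a
   polynomial and iterating, \int (x^2 - r^2) h^(2n) dmu >= 0 for all n.  But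
   |h| <= a < 1 for |x| >= r while h >= b > a near 0, where mu has mass, so
   that this integral is at most a^(2n) M - c b^(2n) m with c, m > 0:
   a contradiction as n grows. *)
Require Import Defs.
From HB Require Import structures.
From mathcomp Require Import all_boot all_order all_algebra.
From mathcomp Require Import all_classical all_reals all_analysis.
From mathcomp Require Import complex.
From mathcomp Require Import measurable_realfun lra ring.

Set Implicit Arguments.
Unset Strict Implicit.
Unset Printing Implicit Defensive.

Import Order.TTheory GRing.Theory Num.Theory numFieldNormedType.Exports.

Local Open Scope classical_set_scope.
Local Open Scope ring_scope.

(** * Growth and exponential type of polynomials *)

Section ComplexPolynomials.
Local Open Scope complex_scope.

Lemma entire_horner (R : realType) (P : {poly R[i]}) :
  entire (fun z : R[i]^o => P.[z]).
Proof.
move=> z; elim/poly_ind: P => [|P c ih].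
  under eq_fun do rewrite horner0; exact: derivable_cst.
under eq_fun do rewrite hornerMXaddC.
apply: derivableD; last exact: derivable_cst.
have did : derivable (id : R[i]^o -> R[i]^o) z 1 by exact: derivable_id.
by have := derivableM ih did.
Qed.

Lemma normc_ge0 (R : rcfType) (z : R[i]) : 0 <= Normc.normc z.
Proof. by case: z => a b; exact: sqrtr_ge0. Qed.

Lemma normc_real (R : rcfType) (x : R) : Normc.normc x%:C = `|x|.
Proof. by rewrite /= expr0n addr0 sqrtr_sqr. Qed.

Lemma ler_expRM (R : realType) (eta y : R) : 0 < eta ->
  y <= eta^-1 * expR (eta * y).
Proof.
move=> eta0; rewrite -(ler_pM2l eta0) mulrA divff ?gt_eqF// mul1r.
by apply: le_trans (expR_ge1Dx _); rewrite lerDr.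
Qed.

(** Horner induction with the rate [eta] left general: half of it goes to the induction hypothesis,
    the other half absorbs the new factor [z] through [ler_expRM]. This yields both type zero and,
    under the exponential moment, integrability. *)
Lemma normc_horner_le (R : realType) (P : {poly R[i]}) (eta : R) : 0 < eta ->
  exists2 C : R, 0 < C &
    forall z, Normc.normc P.[z] <= C * expR (eta * Normc.normc z).
Proof.
elim/poly_ind: P eta => [|P c ih] eta eta0.
  by exists 1 => // z; rewrite horner0 Normc.normc0 mul1r expR_ge0.
have h0 : 0 < eta / 2 by rewrite divr_gt0.
have [C C0 PC] := ih _ h0.
exists (C * (eta / 2)^-1 + Normc.normc c).
  by rewrite ltr_wpDr ?normc_ge0// mulr_gt0// invr_gt0.
move=> z; rewrite hornerMXaddC (le_trans (le_normcD _ _))// mulrDl lerD//.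
  rewrite Normc.normcM {2}(splitr eta) mulrDl expRD mulrACA.
  by rewrite ler_pM ?normc_ge0 ?PC ?ler_expRM.
rewrite ler_peMr ?normc_ge0//.
by rewrite -expR0 ler_expR mulr_ge0 ?normc_ge0// ltW.
Qed.

Lemma horner_real_complex (R : rcfType) (p : {poly R}) (x : R) :
  (map_poly (real_complex R) p).[x%:C] = p.[x]%:C.
Proof. exact: horner_map. Qed.

Lemma horner_le_expR (R : realType) (p : {poly R}) (eta : R) : 0 < eta ->
  exists2 C : R, 0 < C & forall x, `|p.[x]| <= C * expR (eta * `|x|).
Proof.
move=> /(normc_horner_le (map_poly (real_complex R) p))[C C0 pC].
by exists C => // x; rewrite -!normc_real -horner_real_complex.
Qed.

(** Up to sign the leading coefficient is positive, and then the values near [+oo] are eventually at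
    least that coefficient; constants are covered too. *)
Lemma horner_away_from0 (R : realFieldType) (p : {poly R}) : p != 0 ->
  exists2 c : R, 0 < c & exists M, forall x, M <= x -> c <= `|p.[x]|.
Proof.
move=> p0; wlog lp0 : p p0 / 0 < lead_coef p.
  move=> wlg; have := lead_coef_eq0 p; rewrite (negbTE p0).
  case: ltgtP => // [lp _|/(wlg _ p0)//].
  have [||c c0 [M cM]] := wlg (- p);
    rewrite ?oppr_eq0// ?lead_coefN ?oppr_gt0//.
  by exists c => //; exists M => x /cM; rewrite hornerN normrN.
have [M pM] := polyrcf.poly_pinfty_gt_lc lp0.
exists (lead_coef p) => //; exists M => x /pM px.
by rewrite (le_trans px)// ler_norm.
Qed.

Lemma exp_type_horner_le0 (R : realType) (P : {poly R[i]}) :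
  (exp_type (fun z : R[i]^o => P.[z]) <= 0)%E.
Proof.
apply/lee_addgt0Pr => e e0; rewrite add0e.
have h0 : 0 < e / 2 by rewrite divr_gt0.
have [C C0 PC] := normc_horner_le P h0.
(* Beyond [M] one has [ln C < (e / 2) * |z|], so the logarithm of the bound is at most [e * |z|];
   the 1 keeps [|z|] positive. *)
pose M := Num.max 1 (2 * ln C / e).
apply: ge_ereal_inf; eexists.
  exists [set z | M < Normc.normc z] => //.
  by exists M.
apply: ge_ereal_sup => _ [z /= Mz <-].
have [z1 zC] : 1 < Normc.normc z /\ 2 * ln C / e < Normc.normc z.
  by apply/andP; rewrite -gt_max.
have z0 : 0 < Normc.normc z by rewrite (lt_trans _ z1).
(* At a zero of [P] the logarithm is [-oo], and a positive multiple of it stays [-oo]. *)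
rewrite /lne; case: ifPn => [_|].
  by rewrite gt0_muleNy ?leNye// lte_fin invr_gt0.
rewrite -ltNge => P0; rewrite -EFinM lee_fin ler_pdivrMl//.
rewrite (@le_trans _ _ (ln (C * expR (e / 2 * Normc.normc z))))//.
  by rewrite ler_ln ?posrE ?mulr_gt0 ?expR_gt0.
rewrite lnM ?posrE ?expR_gt0// expRK.
have : 2 * ln C < Normc.normc z * e by rewrite -ltr_pdivrMr.
lra.
Qed.

(** Serves only to exclude the value [-oo], since the type must be finite; any real constant would
    do in place of -1. On the positive real axis [|p|] stays above some [c > 0], so
    [ln |p(x)| / x >= -1] once [x >= |ln c|]. *)
Lemma exp_type_horner_geN1 (R : realType) (p : {poly R}) : p != 0 ->
  (- 1%:E <= exp_type (fun z : R[i]^o => (map_poly (real_complex R) p).[z]))%E.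
Proof.
move=> /horner_away_from0[c c0 [M0 pM]].
apply/ereal_infP => _ [V [M _ MV] <-].
pose x := `|M| + `|M0| + `|ln c| + 1.
have x0 : 0 < x by rewrite ltr_wpDl// !addr_ge0.
have Mx : M < x.
  have := ler_norm M; have := normr_ge0 M0; have := normr_ge0 (ln c).
  rewrite /x; lra.
have M0x : M0 <= x.
  have := ler_norm M0; have := normr_ge0 M; have := normr_ge0 (ln c).
  rewrite /x; lra.
apply: le_ereal_sup_tmp; eexists.
  by exists x%:C => //; apply: MV; rewrite /mkset normc_real gtr0_norm.
rewrite horner_real_complex !normc_real gtr0_norm//.
have pc := pM _ M0x; have p0 := lt_le_trans c0 pc.
rewrite lne_EFin// -EFinM lee_fin ler_pdivlMl//.
rewrite (@le_trans _ _ (ln c)) ?ler_ln ?posrE//.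
have := normr_ge0 M; have := normr_ge0 M0; have := ler_norm (- ln c).
by rewrite normrN /x; lra.
Qed.

End ComplexPolynomials.

(** * The cardinal sine: Taylor polynomials and bounds *)

Section Sinc.
Variable R : realType.
Implicit Types (u x : R) (N n : nat).

Definition sinc u : R := if u == 0 then 1 else sin u / u.

(** Taylor polynomial of [sinc]: the coefficients of the sine series at argument 1, shifted by one
    degree to divide by the variable. *)
Definition sinc_poly N : {poly R} := \poly_(k < N) sin_coeff 1 k.+1.

Lemma sin_coeffS u n : sin_coeff u n.+1 = u * (sin_coeff 1 n.+1 * u ^+ n).
Proof. by rewrite /sin_coeff/= expr1n exprS; ring. Qed.

Lemma series_sin_coeffS u N :
  series (sin_coeff u) N.+1 = u * (sinc_poly N).[u].
Proof.
rewrite /series/= big_nat_recl// (sin_coeff_even 0) add0r.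
rewrite horner_poly mulr_sumr big_mkord.
by apply: eq_bigr => i _; exact: sin_coeffS.
Qed.

Lemma sinc_poly0 N : (sinc_poly N.+1).[0] = 1.
Proof.
rewrite horner_coef0 coef_poly/= /sin_coeff/=.
by rewrite expr0 expr1n !mulr1 divr1.
Qed.

Lemma cvg_sinc_poly u : (sinc_poly N).[u] @[N --> \oo] --> sinc u.
Proof.
rewrite /sinc; have [->|u0] := eqVneq u 0.
  (* The empty polynomial [sinc_poly 0] vanishes at 0, so the sequence is constantly 1 only from
     index 1 on. *)
  rewrite -(cvg_shiftS (fun N => (sinc_poly N).[0])).
  under eq_fun do rewrite sinc_poly0.
  exact: cvg_cst.
have -> : (fun N => (sinc_poly N).[u]) =
    (fun N => series (sin_coeff u) N.+1 * u^-1).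
  by apply/funext => N; rewrite series_sin_coeffS mulrAC divff// mul1r.
apply: cvgMl; rewrite (cvg_shiftS (series (sin_coeff u))) sin.unlock.
exact: is_cvg_series_sin_coeff.
Qed.

(** Termwise comparison with the exponential series, as [1 / (k + 1)! <= 1 / k!]; the partial sums
    of the latter increase to [expR]. *)
Lemma sinc_poly_le u N : `|(sinc_poly N).[u]| <= expR `|u|.
Proof.
apply: (@le_trans _ _ (series (exp_coeff `|u|) N)); last first.
  apply: nondecreasing_cvgn_le (is_cvg_series_exp_coeff _) N.
  apply/nondecreasing_seqP => n; rewrite seriesSr lerDl.
  exact: exp_coeff_ge0.
rewrite horner_poly /series/= big_mkord.
apply: le_trans (ler_norm_sum _ _ _) _; apply: ler_sum => k _.
rewrite normrM normrX /exp_coeff/= mulrC ler_wpM2l ?exprn_ge0//.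
rewrite /sin_coeff/= expr1n mulr1 !normrM normrX normrN1 expr1n mulr1.
rewrite normfV !normr_nat -[leRHS]mul1r.
rewrite ler_pM ?invr_ge0 ?ler0n ?lern1 ?leq_b1//.
by rewrite lef_pV2 ?posrE ?ltr0n ?fact_gt0// ler_nat leq_fact.
Qed.

Lemma sincN u : sinc (- u) = sinc u.
Proof. by rewrite /sinc oppr_eq0 sinN invrN mulrNN. Qed.

Lemma sinc_norm u : sinc `|u| = sinc u.
Proof. by case: (ger0P u) => // _; rewrite sincN. Qed.

(** The mean value theorem for [sin] on [[0, |u|]]. Bounds on [sinc], both global and near 0,
    thereby reduce to bounds on [cos]. *)
Lemma sinc_cos u : exists2 c, `|c| <= `|u| & sinc u = cos c.
Proof.
rewrite -sinc_norm; have := normr_ge0 u; move: `|u| => v v0.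
have [->|vneq0] := eqVneq v 0.
  by exists 0; rewrite ?normr0 // /sinc eqxx cos0.
have [|c /[!in_itv]/= /andP[c0 cv]] :=
    @MVT_segment R sin cos 0 v v0 (fun x _ => is_derive_sin x).
  by apply: continuous_subspaceT => x; exact: continuous_sin.
rewrite sin0 !subr0 => sv; exists c; first by rewrite ger0_norm.
by rewrite /sinc (negbTE vneq0) sv mulfK.
Qed.

Lemma sinc_le1 u : `|sinc u| <= 1.
Proof. by have [c _ ->] := sinc_cos u; exact: cos_max. Qed.

Lemma sin_le u : `|sin u| <= `|u|.
Proof.
have [->|u0] := eqVneq u 0; first by rewrite sin0.
have := sinc_le1 u; rewrite /sinc (negbTE u0) normrM normfV.
by rewrite ler_pdivrMr ?normr_gt0// mul1r.
Qed.

Lemma sinc_ge_near0 b : b < 1 ->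
  exists2 rho, 0 < rho & forall u, `|u| <= rho -> b <= sinc u.
Proof.
move=> b1; have /cvgrPdist_lt/(_ (1 - b)) :
    cos x @[x --> (0 : R)] --> cos (0 : R).
  exact: continuous_cos.
rewrite subr_gt0 => /(_ b1) /nbhs_ballP[e /= e0 cose].
exists (e / 2); first by rewrite divr_gt0.
move=> u ue; have [c cu ->] := sinc_cos u.
have /cose : ball 0 e c by rewrite /ball/= sub0r normrN; lra.
by rewrite cos0 => /ltr_normlW; lra.
Qed.

(** For [|u| >= 2] the bound [1 / |u| <= 1 / 2] suffices. Below 2,
    [sinc u = cos (u / 2) * sinc (u / 2)] is controlled by the cosine, which decreases there. *)
Lemma sinc_lt1_away u0 : 0 < u0 ->
  exists2 a, 0 < a < 1 & forall u, u0 <= `|u| -> `|sinc u| <= a.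
Proof.
(* Capping at 2 puts [v0 / 2] in [(0, 1]], inside the range where [cos] is nonnegative and
   decreasing. *)
move=> u0_gt0; pose v0 := Num.min u0 2.
have v0_gt0 : 0 < v0 by rewrite lt_min u0_gt0/=.
have v0_le2 : v0 <= 2 by rewrite ge_min lexx orbT.
have pi2 := pi_ge2 R.
have cosv1 : cos (v0 / 2) < 1.
  by rewrite -[ltRHS]cos0 ltr_cos ?in_itv/= ?lexx; lra.
exists (Num.max (cos (v0 / 2)) (1 / 2)).
  by rewrite lt_max gt_max cosv1/=; apply/andP; split; [apply/orP; right|]; lra.
move=> u; rewrite -sinc_norm => u0u.
have v0u : v0 <= `|u| by rewrite ge_min u0u.
move: (`|u|) v0u => {u0u} {}u v0u; have u_gt0 := lt_le_trans v0_gt0 v0u.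
rewrite /sinc gt_eqF// normrM normfV (gtr0_norm u_gt0) ler_pdivrMr//.
have [u2|/ltW u2] := leP 2 u.
  rewrite (le_trans (sin_max _))// -ler_pdivrMr// le_max; apply/orP; right.
  by rewrite mul1r mul1r lef_pV2 ?posrE//; lra.
(* [sin u = 2 * cos (u / 2) * sin (u / 2)] with [sin (u / 2) <= u / 2] *)
rewrite -{1}(mulfVK (_ : 2 != 0) u)//.
rewrite (_ : u / 2 * 2 = u / 2 *+ 2); last by rewrite mulr_natr.
rewrite sin_mulr2n normrMn normrM.
rewrite ger0_norm; last by apply: cos_ge0_pihalf; lra.
have cosu : cos (u / 2) <= cos (v0 / 2) by rewrite leNgt ltr_cos ?in_itv/=; lra.
have c0 : 0 <= cos (u / 2) by apply: cos_ge0_pihalf; lra.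
have su := sin_le (u / 2).
rewrite [leRHS]ger0_norm in su; last lra.
apply: (@le_trans _ _ (cos (v0 / 2) * (u / 2) *+ 2)).
  by rewrite lerMn2r/= ler_pM.
rewrite -mulrnAr -[u / 2 *+ 2]mulr_natr divfK// ler_pM2r// le_max lexx//.
Qed.
End Sinc.

(** * Integration against a measure with an exponential moment *)

Section ExponentialMoment.
Variables (R : realType) (mu : {measure set (measurableTypeR R) -> \bar R}).
Variables (e : R) (e_gt0 : 0 < e).
Hypothesis mu_exp : (\int[mu]_x (expR (e * `|x|))%:E < +oo)%E.

Lemma integrable_expR (C : R) :
  mu.-integrable setT (fun x => (C * expR (e * `|x|))%:E).
Proof.
under eq_fun do rewrite EFinM; apply: integrableZl => //.
apply/integrableP; split; last first.
  by under eq_integral do rewrite gee0_abs ?lee_fin ?expR_ge0//.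
apply/measurable_EFinP; apply: measurableT_comp => //.
exact: measurable_funM.
Qed.

Lemma integrable_dominated (C : R) (f : R -> R) : measurable_fun setT f ->
  (forall x, `|f x| <= C * expR (e * `|x|)) -> mu.-integrable setT (EFin \o f).
Proof.
move=> mf fC; apply: (le_integrable _ _ _ (integrable_expR C)) => //.
  exact/measurable_EFinP.
by move=> x _; rewrite lee_fin (le_trans (fC x))// ler_norm.
Qed.

Lemma integrable_horner (p : {poly R}) :
  mu.-integrable setT (EFin \o horner p).
Proof.
have [C C0 pC] := horner_le_expR p e_gt0.
by apply: (@integrable_dominated C) => //; exact: measurable_poly.
Qed.

Lemma measurable_sinc : measurable_fun setT (@sinc R).
Proof.
apply: (@measurable_fun_cvg _ _ _ _ (fun N => horner (sinc_poly R N)))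
  => [N|x _].
  exact: measurable_poly.
exact: cvg_sinc_poly.
Qed.

(** Induction on [n]: one factor [sinc ^+ 2] is the limit of squares of polynomials [q N], and each
    [q N] is absorbed into [p]. Hence the quantification over all [p] inside the induction. *)
Lemma integral_sqr_sinc_ge0 (w : {poly R}) :
  (forall p : {poly R}, 0 <= \int[mu]_x ((w * p ^+ 2).[x])%:E)%E ->
  forall n (p : {poly R}),
    (0 <= \int[mu]_x ((w * p ^+ 2).[x] * sinc (e / 4 * x) ^+ (2 * n))%:E)%E.
Proof.
move=> w_ge0; elim=> [|n ih] p.
  by under eq_integral do rewrite muln0 expr0 mulr1; exact: w_ge0.
pose q N := sinc_poly R N \Po (e / 4 *: 'X).
have qE N x : (q N).[x] = (sinc_poly R N).[e / 4 * x].
  by rewrite horner_comp hornerZ hornerX.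
have msinc : measurable_fun setT (fun x : R => sinc (e / 4 * x)).
  by apply: measurableT_comp; [exact: measurable_sinc|exact: measurable_funM].
(* The rate [e] is split in two: [e / 2] for [w * p ^+ 2] and [e / 2] for [(q N) ^+ 2], each factor
   [q N] growing at rate at most [e / 4]. This fixes the scale of [sinc]. *)
have e2 : 0 < e / 2 by rewrite divr_gt0.
have [C C0 pC] := horner_le_expR (w * p ^+ 2) e2.
pose f N x := (w * (p * q N) ^+ 2).[x] * sinc (e / 4 * x) ^+ (2 * n).
have mf N : measurable_fun setT (f N).
  by apply: measurable_funM; [exact: measurable_poly|exact: measurable_funX].
have fE N x : f N x =
    (w * p ^+ 2).[x] * ((q N).[x] ^+ 2 * sinc (e / 4 * x) ^+ (2 * n)).
  by rewrite /f !(hornerM, horner_exp); ring.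
have [|||||_ _ cvgf] := @dominated_convergence _ _ _ mu _ measurableT
  (fun N x => (f N x)%:E)
  (fun x => ((w * p ^+ 2).[x] * sinc (e / 4 * x) ^+ (2 * n.+1))%:E)
  (fun x => (C * expR (e * `|x|))%:E).
- by move=> N; apply/measurable_EFinP; exact: mf.
- apply/measurable_EFinP; apply: measurable_funM; first exact: measurable_poly.
  exact: measurable_funX.
- apply: aeW => x _; apply: cvg_EFin; first exact: nearW.
  under [X in X @ _ --> _]eq_fun do rewrite /= fE.
  rewrite mulnS exprD; apply: cvgMr; apply: cvgMl.
  under eq_fun do rewrite qE expr2; rewrite expr2.
  by apply: cvgM; exact: cvg_sinc_poly.
- exact: integrable_expR.
- apply: aeW => x N _; rewrite lee_fin fE normrM.
  rewrite {2}(splitr e) mulrDl expRD mulrA ler_pM ?pC//.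
  rewrite normrM -[leRHS]mulr1 ler_pM//; last first.
    by rewrite normrX exprn_ile1// sinc_le1.
  have -> : e / 2 * `|x| = 2%:R * (e / 4 * `|x|) by field.
  rewrite normrX qE expRM_natl lerXn2r ?nnegrE ?expR_ge0//.
  apply: le_trans (sinc_poly_le _ _) _.
  by rewrite normrM gtr0_norm// divr_gt0.
rewrite -(cvg_lim (@ereal_hausdorff R) cvgf); apply: lime_ge.
  by apply/cvg_ex; eexists; exact: cvgf.
by apply: nearW => N /=; exact: ih.
Qed.

Lemma exists_integral_sqr_le0 (r : R) : 0 < r ->
  (forall rho, 0 < rho -> (0 < mu [set` `[- rho, rho]%R])%E) ->
  exists2 p : {poly R}, p != 0 &
    (\int[mu]_x ((('X^2 - (r ^+ 2)%:P) * p ^+ 2).[x])%:E <= 0)%E.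
Proof.
move=> r0 mu_pos; set w := 'X^2 - _; apply: contrapT => noex.
have {noex} w_ge0 (p : {poly R}) : (0 <= \int[mu]_x ((w * p ^+ 2).[x])%:E)%E.
  (* The negated claim speaks of nonzero [p] only; for [p = 0] the integral is 0. *)
  have [->|p0] := eqVneq p 0.
    by under eq_integral do rewrite expr0n mulr0 horner0; rewrite integral0.
  by rewrite leNgt; apply/negP => /ltW le0; apply: noex; exists p.
have l0 : 0 < e / 4 by rewrite divr_gt0.
have [a /andP[a0 a1] sinc_le] := sinc_lt1_away (mulr_gt0 l0 r0).
pose b := (1 + a) / 2.
have ab : a < b by rewrite /b; lra.
have b0 : 0 < b by rewrite (lt_trans a0).
have [rho' rho'0 sinc_ge] : exists2 rho : R, 0 < rho &
    forall u, `|u| <= rho -> b <= sinc u.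
  by apply: sinc_ge_near0; rewrite /b; lra.
(* The first bound gives [sinc (e / 4 * x) >= b] on [D], the second gives [w.[x] <= - c] there. *)
pose rho := Num.min (rho' / (e / 4)) (r / 2).
have rho0 : 0 < rho by rewrite lt_min !divr_gt0.
pose D : set R := [set` `[- rho, rho]%R].
have DP x : D x -> `|x| <= rho by rewrite /D /= in_itv/= ler_norml.
have mD : measurable D by exact: measurable_itv.
pose c := r ^+ 2 - (r / 2) ^+ 2.
have c0 : 0 < c by rewrite /c subr_gt0 ltr_pXn2r ?nnegrE//; lra.
pose s n (x : R) := sinc (e / 4 * x) ^+ (2 * n).
have s_ge0 n x : 0 <= s n x by rewrite /s exprM exprn_ge0 ?sqr_ge0.
have s_le1 n x : s n x <= 1.
  by rewrite -[s n x]ger0_norm// normrX exprn_ile1// sinc_le1.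
have wE x : w.[x] = x ^+ 2 - r ^+ 2 by rewrite /w !hornerE.
(* On [D] the left side is at most [c * (b ^+ 2) ^+ n - c * s n x <= 0]. Off [D] the indicator
   vanishes: for [|x| < r] the factor [w] is negative, and for [|x| >= r] both [w.[x] <= x ^+ 2] and
   [s n x <= (a ^+ 2) ^+ n] hold. *)
have pointwise n x :
    w.[x] * s n x + c * (b ^+ 2) ^+ n * \1_D x <= (a ^+ 2) ^+ n * x ^+ 2.
  have rhs0 : 0 <= (a ^+ 2) ^+ n * x ^+ 2.
    by rewrite mulr_ge0 ?sqr_ge0// exprn_ge0// sqr_ge0.
  rewrite wE indicE; have [xD|xD] := boolP (x \in D); last first.
    rewrite mulr0 addr0; have [rx|xr] := leP r `|x|; last first.
      apply: le_trans rhs0; rewrite mulr_le0_ge0//.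
      rewrite subr_le0 -real_normK ?num_real//.
      by rewrite lerXn2r ?nnegrE ?(ltW r0) ?(ltW xr).
    have sa : s n x <= (a ^+ 2) ^+ n.
      rewrite /s exprM lerXn2r ?nnegrE ?sqr_ge0//.
      rewrite -real_normK ?num_real// lerXn2r ?nnegrE ?(ltW a0)// sinc_le//.
      by rewrite normrM (gtr0_norm l0) ler_pM2l.
    rewrite mulrC ler_pM//; last by rewrite lerBlDr lerDl sqr_ge0.
    rewrite subr_ge0 -[leRHS]real_normK ?num_real//.
    by rewrite lerXn2r ?nnegrE ?(ltW r0).
  apply: le_trans rhs0; rewrite mulr1.
  have {}xD : `|x| <= rho by apply: DP; exact: set_mem.
  have /andP[xrho' xr2] : (`|x| <= rho' / (e / 4)) && (`|x| <= r / 2).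
    by rewrite -le_min.
  have sb : (b ^+ 2) ^+ n <= s n x.
    rewrite /s exprM lerXn2r ?nnegrE ?sqr_ge0// lerXn2r ?nnegrE ?(ltW b0)//.
      by apply: le_trans (ltW b0) (sinc_ge _ _);
        rewrite normrM (gtr0_norm l0) mulrC -ler_pdivlMr.
    by apply: sinc_ge; rewrite normrM (gtr0_norm l0) mulrC -ler_pdivlMr.
  have xc : x ^+ 2 - r ^+ 2 <= - c.
    by rewrite /c opprB lerB// -real_normK ?num_real// lerXn2r ?nnegrE//; lra.
  apply: (@le_trans _ _ (- c * s n x + c * (b ^+ 2) ^+ n)).
    by rewrite lerD2r ler_wpM2r.
  by rewrite mulNr addrC subr_le0 ler_pM2l.
have ix2 : mu.-integrable setT (EFin \o (fun x : R => x ^+ 2)).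
  have := integrable_horner 'X^2; apply: eq_integrable => // x _ /=.
  by rewrite hornerXn.
have i1D : mu.-integrable setT (EFin \o \1_D).
  apply: (@integrable_dominated 1); first exact: measurable_indic.
  move=> x; rewrite mul1r (@le_trans _ _ 1)//.
    by rewrite indicE; case: (_ \in _); rewrite ?normr1 ?normr0.
  by rewrite -expR0 ler_expR mulr_ge0// ltW.
have iws n : mu.-integrable setT (EFin \o (fun x => w.[x] * s n x)).
  apply: (le_integrable _ _ _ (integrable_horner w)) => //.
    apply/measurable_EFinP.
    apply: measurable_funM; first exact: measurable_poly.
    apply: measurable_funX.
    apply: measurableT_comp; first exact: measurable_sinc.
    exact: measurable_funM.
  by move=> x _; rewrite lee_fin normrM ler_piMr// ger0_norm.
have muD_fin : mu D \is a fin_num.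
  have := integrable_fin_num measurableT i1D.
  by rewrite integral_indic// setIT.
pose M := fine (\int[mu]_x (x ^+ 2)%:E); pose m := fine (mu D).
have ME : (\int[mu]_x (x ^+ 2)%:E)%E = M%:E.
  by rewrite fineK//; have := integrable_fin_num measurableT ix2.
have mE : mu D = m%:E by rewrite fineK.
have m0 : 0 < m by rewrite -lte_fin -mE; exact: mu_pos.
(* Integrate [pointwise] and drop the integral of [w * s n], which is nonnegative by
   [integral_sqr_sinc_ge0] at [p = 1]. *)
have key n : c * (b ^+ 2) ^+ n * m <= (a ^+ 2) ^+ n * M.
  have ic1D : mu.-integrable setT
      (fun x => (c * (b ^+ 2) ^+ n)%:E * (\1_D x)%:E)%E.
    exact: integrableZl.
  have : (\int[mu]_x ((w.[x] * s n x)%:E +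
                         (c * (b ^+ 2) ^+ n)%:E * (\1_D x)%:E) <=
          \int[mu]_x (((a ^+ 2) ^+ n)%:E * (x ^+ 2)%:E))%E.
    apply: le_integral => //; first by apply: integrableD => //; exact: iws.
      exact: integrableZl.
    by move=> x _; rewrite -!EFinM -EFinD lee_fin; exact: pointwise.
  rewrite integralD//; last exact: iws.
  rewrite !integralZl// integral_indic// setIT mE ME -!EFinM.
  rewrite -lee_fin; apply: le_trans; rewrite leeDr//.
  have := integral_sqr_sinc_ge0 w_ge0 n 1.
  by rewrite expr1n mulr1.
pose q := a ^+ 2 / b ^+ 2.
have q0 : 0 <= q by rewrite divr_ge0// sqr_ge0.
have q1 : q < 1.
  rewrite ltr_pdivrMr ?exprn_gt0// mul1r.
  by rewrite ltr_pXn2r ?nnegrE ?(ltW a0) ?(ltW b0).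
(* Dividing [key] by [(b ^+ 2) ^+ n] bounds the fixed positive number [c * m] by [q ^+ n * M], which
   tends to 0. *)
have cvgq : q ^+ n * M @[n --> \oo] --> 0 * M.
  by apply: cvgMl; apply: cvg_expr; rewrite ger0_norm.
have : c * m <= 0.
  rewrite -(mul0r M) -(cvg_lim (@Rhausdorff R) cvgq); apply: limr_ge.
    by apply/cvg_ex; eexists; exact: cvgq.
  apply: nearW => n; rewrite /q expr_div_n mulrAC ler_pdivlMr ?exprn_gt0//.
  by rewrite mulrAC; exact: key.
by rewrite leNgt mulr_gt0.
Qed.
End ExponentialMoment.

(** * Vanishing of the sign uncertainty infimum *)

Theorem theorem3 (R : realType)
    (mu : {measure set (measurableTypeR R) -> \bar R})
    (mu_locfin : locally_finite mu)
    (mu_even : even_measure mu)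
    (mu_pos : forall r : R, 0 < r -> (0 < mu [set` `[- r, r]%R])%E)
    (mu_exp : exists2 e : R, 0 < e &
       (\int[mu]_x (expR (e * `|x|))%:E < +oo)%E) :
  forall delta : R, 0 <= delta -> sign_uncertainty mu delta = 0%E.
Proof.
move=> delta delta0; have [e e0 fin_e] := mu_exp.
apply/eqP; rewrite eq_le; apply/andP; split; last first.
  apply/ereal_infP => _ [F _ <-]; apply/ereal_infP => _ [r [r0 _] <-].
  by rewrite lee_fin ltW.
(* The infimum need not be attained: for each [r > 0] a separate competitor bounds it by [r]. *)
apply/lee_addgt0Pr => r r0; rewrite add0e.
have [p p0 int_p] := exists_integral_sqr_le0 e0 fin_e r0 mu_pos.
pose P : {poly R} := ('X^2 - (r ^+ 2)%:P) * p ^+ 2.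
have P0 : P != 0.
  rewrite mulf_neq0 ?expf_neq0// -size_poly_eq0.
  by rewrite size_XnsubC.
have PE x : P.[x] = (x ^+ 2 - r ^+ 2) * p.[x] ^+ 2 by rewrite !hornerE.
have P_ge0 x : r <= `|x| -> 0 <= P.[x].
  move=> rx; rewrite PE mulr_ge0 ?sqr_ge0// subr_ge0 -(real_normK (num_real x)).
  by rewrite lerXn2r ?nnegrE ?(ltW r0).
pose F (z : R[i]^o) : R[i]^o := (map_poly (real_complex R) P).[z].
have FE : real_restr F = horner P.
  by apply/funext => x; rewrite /real_restr /F horner_real_complex.
have F_type : exp_type_at_most delta F.
  have le0 := exp_type_horner_le0 (map_poly (real_complex R) P).
  have geN1 := exp_type_horner_geN1 P0.
  right; split; last by rewrite (le_trans le0)// lee_fin.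
  by rewrite fin_numElt (lt_le_trans _ geN1) ?(le_lt_trans le0) ?ltry ?ltNyr.
apply: ge_ereal_inf; exists (last_sign_change (real_restr F)).
  exists F => //; split; first split=> //.
  - by split=> [|x]; [exact: entire_horner | rewrite /F horner_real_complex].
  - by rewrite FE; exact: integrable_horner e0 fin_e P.
  - by rewrite FE.
  - by exists r; rewrite FE.
  (* The threshold [M] itself is a point where [P], hence [F], does not vanish. *)
  have [c c0 [M /(_ M (lexx _)) cM]] := horner_away_from0 P0.
  exists (M%:C)%C; rewrite /F horner_real_complex => -[PM].
  by move: cM; rewrite PM normr0 leNgt c0.
by rewrite FE; apply: ge_ereal_inf; exists r%:E => //; exists r.
Qed.
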